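(* Let $A$ be a commutative Noetherian ring with unit, $M$ a finitely generated $A$-module and $n,l$ natural numbers. Then $M$ has the property $(C_n^l)$ if and only if $\operatorname{cmd}_{A_\mathfrak{p}}(M_\mathfrak{p})\le l$ for every prime ideal $\mathfrak{p}$ of $A$ such that $\operatorname{depth}(M_\mathfrak{p})\le n-l-1$.
   Context: Natural numbers include $0$; all inequalities are between integers (so $n-l-1$ may be negative) or $\infty$. The depth of the zero module is $\infty$. For a Noetherian local ring $R$ and a nonzero finitely generated $R$-module $N$, the Cohen-Macaulay defect is $\operatorname{cmd}_R(N)=\dim(N)-\operatorname{depth}_R(N)$, and $\operatorname{cmd}_R(0)=0$. For natural numbers $n,l$, a finitely generated $A$-module $M$ has the property $(C_n^l)$ if $\operatorname{depth}(M_\mathfrak{p})\ge\min(\dim(M_\mathfrak{p}),n)-l$ for every $\mathfrak{p}\in\operatorname{Spec}(A)$ (depth taken over $A_\mathfrak{p}$; the condition holds automatically when $M_\mathfrak{p}=0$). *)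

(* Defs.v *)
From HB Require Import structures.
From mathcomp Require Import all_boot all_order all_algebra ring.
From mathcomp Require Import boolp classical_sets constructive_ereal.

Set Implicit Arguments.
Unset Strict Implicit.
Unset Printing Implicit Defensive.

Import Order.TTheory GRing.Theory Num.Theory.

Local Open Scope classical_set_scope.
Local Open Scope ring_scope.
Local Open Scope quotient_scope.

Section Basics.
Variable R : comPzRingType.

Definition is_ideal (I : set R) : Prop :=
  [/\ I 0, forall x y, I x -> I y -> I (x + y) & forall a x, I x -> I (a * x)].

(* [prime_idealr] of ring_quotient is restricted to nonzero rings and to
   boolean predicates; here the zero ring is allowed (its spectrum is empty). *)
Definition is_prime (p : set R) : Prop :=
  [/\ is_ideal p, ~ p 1 & forall x y, p (x * y) -> p x \/ p y].

Record spec := Spec { spec_set :> R -> Prop; specP : is_prime spec_set }.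

Definition submod_gen (N : lmodType R) (s : seq N) : set N :=
  [set v | exists c : 'I_(size s) -> R, v = \sum_(i < size s) c i *: s`_i].

Definition fin_gen (N : lmodType R) : Prop :=
  exists s : seq N, submod_gen s = setT.

Definition noetherian : Prop :=
  forall I : set R, is_ideal I -> exists s : seq R^o, submod_gen s = I.

End Basics.

(* For a prime p, [locmod p M] is M_p and [locring p] is A_p; two fractions
   n/s and m/t are equal when u(tn) = u(sm) for some u outside p. *)

Section LocalizationModule.
Variables (A : comPzRingType) (p : spec A).

Lemma spec1 : ~ p 1. Proof. by have [] := specP p. Qed.

Lemma specM s t : ~ p s -> ~ p t -> ~ p (s * t).
Proof. by have [_ _ pM] := specP p => ps pt /pM[]. Qed.

Definition denom : Type := {s : A | `[< ~ p s >]}.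

Definition dval (s : denom) : A := proj1_sig s.

Lemma denomP (s : denom) : ~ p (dval s).
Proof. exact/asboolP/(proj2_sig s). Qed.

Definition mk_denom s (ps : ~ p s) : denom := exist _ s (asboolT ps).
Definition denom1 : denom := mk_denom spec1.
Definition denomM (s t : denom) : denom :=
  mk_denom (specM (@denomP s) (@denomP t)).

Lemma dval1 : dval denom1 = 1. Proof. by []. Qed.

Lemma dvalM s t : dval (denomM s t) = dval s * dval t. Proof. by []. Qed.

Variable M : lmodType A.

Definition loc_rel (x y : M * denom) : bool :=
  `[< exists2 u, ~ p u & u *: (dval y.2 *: x.1) = u *: (dval x.2 *: y.1) >].

Lemma loc_rel_refl : reflexive loc_rel.
Proof. by move=> x; apply/asboolP; exists 1 => //; exact: spec1. Qed.

Lemma loc_rel_sym : symmetric loc_rel.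
Proof.
by move=> x y; apply/asboolP/asboolP => -[u pu e]; exists u; rewrite ?e.
Qed.

Lemma loc_rel_trans : transitive loc_rel.
Proof.
move=> [m t] [n s] [k w] /asboolP[u pu /= e] /asboolP[v pv /= f].
apply/asboolP => /=; exists (u * v * dval t).
  by apply: specM; [exact: specM | exact: denomP].
transitivity ((v * dval w) *: (u *: (dval t *: n))).
  by rewrite !scalerA; congr (_ *: _); ring.
rewrite e; transitivity ((u * dval s) *: (v *: (dval w *: m))).
  by rewrite !scalerA; congr (_ *: _); ring.
by rewrite f !scalerA; congr (_ *: _); ring.
Qed.

Canonical loc_equiv := EquivRel loc_rel loc_rel_refl loc_rel_sym loc_rel_trans.

Definition locmod : Type := {eq_quot loc_equiv}.
HB.instance Definition _ : EqQuotient _ loc_equiv locmod :=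
  EqQuotient.on locmod.
HB.instance Definition _ := Choice.on locmod.

Definition frac (m : M) (s : denom) : locmod := \pi_locmod (m, s).

Lemma fracP (m n : M) (s t : denom) :
  frac m s = frac n t <->
  exists2 u, ~ p u & u *: (dval t *: m) = u *: (dval s *: n).
Proof.
rewrite /frac; split => [/eqP|h].
  by rewrite eqmodE => /asboolP.
by apply/eqP; rewrite eqmodE; apply/asboolP.
Qed.

Lemma fracW (P : locmod -> Prop) : (forall m s, P (frac m s)) -> forall x, P x.
Proof. by move=> h x; rewrite -[x]reprK; case: (repr x). Qed.

Lemma frac_repr x : frac (repr x).1 (repr x).2 = x.
Proof. by rewrite /frac -surjective_pairing reprK. Qed.

Definition loc_add (x y : locmod) : locmod :=
  frac (dval (repr y).2 *: (repr x).1 + dval (repr x).2 *: (repr y).1)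
       (denomM (repr x).2 (repr y).2).

Definition loc_opp (x : locmod) : locmod := frac (- (repr x).1) (repr x).2.

Lemma loc_addE m n s t :
  loc_add (frac m s) (frac n t) = frac (dval t *: m + dval s *: n) (denomM s t).
Proof.
rewrite /loc_add; move: (frac_repr (frac m s)) (frac_repr (frac n t)).
set x := repr _; set y := repr _.
move: x y => [m' s'] [n' t'] /= /fracP[u pu e] /fracP[v pv f].
apply/fracP; exists (u * v); first exact: specM.
rewrite /= ?(dvalM, dval1) !scalerDr; congr (_ + _).
  transitivity ((v * dval t * dval t') *: (u *: (dval s *: m'))).
    by rewrite !scalerA; congr (_ *: _); ring.
  by rewrite e !scalerA; congr (_ *: _); ring.
transitivity ((u * dval s * dval s') *: (v *: (dval t *: n'))).
  by rewrite !scalerA; congr (_ *: _); ring.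
by rewrite f !scalerA; congr (_ *: _); ring.
Qed.

Lemma loc_oppE m s : loc_opp (frac m s) = frac (- m) s.
Proof.
rewrite /loc_opp; move: (frac_repr (frac m s)); set x := repr _.
move: x => [m' s'] /= /fracP[u pu e].
by apply/fracP; exists u => //=; rewrite !scalerN e.
Qed.

Lemma loc_addA : associative loc_add.
Proof.
elim/fracW=> m s; elim/fracW=> n t; elim/fracW=> k w; rewrite !loc_addE.
apply/fracP; exists 1; first exact: spec1.
rewrite /= ?(dvalM, dval1) !scalerDr !scalerA addrA.
by congr (_ *: _ + _ *: _ + _ *: _); ring.
Qed.

Lemma loc_addC : commutative loc_add.
Proof.
elim/fracW=> m s; elim/fracW=> n t; rewrite !loc_addE addrC.
by apply/fracP; exists 1; [exact: spec1 | rewrite /= ?(dvalM, dval1) mulrC].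
Qed.

Lemma loc_add0 : left_id (frac 0 denom1) loc_add.
Proof.
elim/fracW=> m s; rewrite loc_addE; apply/fracP; exists 1; first exact: spec1.
by rewrite /= ?(dvalM, dval1) scaler0 add0r !scalerA !mul1r mulr1.
Qed.

Lemma loc_addN : left_inverse (frac 0 denom1) loc_opp loc_add.
Proof.
elim/fracW=> m s; rewrite loc_oppE loc_addE.
apply/fracP; exists 1; first exact: spec1.
by rewrite /= ?(dvalM, dval1) scalerN addNr !scaler0.
Qed.

HB.instance Definition _ :=
  GRing.isZmodule.Build locmod loc_addA loc_addC loc_add0 loc_addN.

End LocalizationModule.

Section LocalizationRing.
Variables (A : comPzRingType) (p : spec A).

Definition locring : Type := locmod p A^o.
HB.instance Definition _ := GRing.Zmodule.on locring.

Definition rfrac (a : A) (s : denom p) : locring := frac (a : A^o) s.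

Lemma rfracP a b s t :
  rfrac a s = rfrac b t <-> exists2 u, ~ p u & u * (dval t * a) = u * (dval s * b).
Proof. exact: fracP. Qed.

Lemma rfracW (P : locring -> Prop) :
  (forall a s, P (rfrac a s)) -> forall x, P x.
Proof. by move=> h; exact: (@fracW A p A^o P h). Qed.

Lemma rfrac_add a b s t :
  rfrac a s + rfrac b t = rfrac (dval t * a + dval s * b) (denomM s t).
Proof. exact: loc_addE. Qed.

Variable M : lmodType A.

Definition loc_scale (x : locring) (y : locmod p M) : locmod p M :=
  frac (((repr x).1 : A) *: (repr y).1) (denomM (repr x).2 (repr y).2).

Lemma loc_scaleE a s m t :
  loc_scale (rfrac a s) (frac m t) = frac (a *: m) (denomM s t).
Proof.
rewrite /loc_scale /rfrac.
move: (frac_repr (frac (a : A^o) s)) (frac_repr (frac m t)).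
set x := repr _; set y := repr _.
move: x y => [a' s'] [m' t'] /= /rfracP[u pu e] /fracP[v pv f].
apply/fracP; exists (u * v); first exact: specM.
rewrite /= ?(dvalM, dval1).
transitivity ((u * (dval s * a')) *: (v *: (dval t *: m'))).
  by rewrite !scalerA; congr (_ *: _); ring.
by rewrite e f !scalerA; congr (_ *: _); ring.
Qed.

End LocalizationRing.

Section LocalizationRingInstance.
Variables (A : comPzRingType) (p : spec A).

Definition loc_mul (x y : locring p) : locring p := loc_scale x y.

Lemma loc_mulE (a b : A) (s t : denom p) :
  loc_mul (rfrac a s) (rfrac b t) = rfrac (a * b) (denomM s t).
Proof. exact: loc_scaleE. Qed.

Lemma loc_mulA : associative loc_mul.
Proof.
elim/rfracW=> a s; elim/rfracW=> b t; elim/rfracW=> c w; rewrite !loc_mulE.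
by apply/rfracP; exists 1; [exact: spec1 | rewrite /= ?(dvalM, dval1); ring].
Qed.

Lemma loc_mulC : commutative loc_mul.
Proof.
elim/rfracW=> a s; elim/rfracW=> b t; rewrite !loc_mulE.
by apply/rfracP; exists 1; [exact: spec1 | rewrite /= ?(dvalM, dval1); ring].
Qed.

Lemma loc_mul1 : left_id (rfrac 1 (denom1 p)) loc_mul.
Proof.
elim/rfracW=> a s; rewrite !loc_mulE.
by apply/rfracP; exists 1; [exact: spec1 | rewrite /= ?(dvalM, dval1); ring].
Qed.

Lemma loc_mulDl : left_distributive loc_mul +%R.
Proof.
elim/rfracW=> a s; elim/rfracW=> b t; elim/rfracW=> c w.
rewrite !(loc_mulE, rfrac_add).
by apply/rfracP; exists 1; [exact: spec1 | rewrite /= ?(dvalM, dval1); ring].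
Qed.

HB.instance Definition _ :=
  GRing.Zmodule_isComPzRing.Build (locring p)
    loc_mulA loc_mulC loc_mul1 loc_mulDl.

Variable M : lmodType A.

Lemma loc_scaleA (x y : locring p) (v : locmod p M) :
  loc_scale x (loc_scale y v) = loc_scale (x * y) v.
Proof.
move: x y v.
elim/rfracW=> a s; elim/rfracW=> b t; elim/fracW=> m w.
rewrite [rfrac a s * _]loc_mulE !loc_scaleE.
apply/fracP; exists 1; first exact: spec1.
by rewrite /= ?(dvalM, dval1) !scalerA; congr (_ *: _); ring.
Qed.

Lemma loc_scale1 : left_id (1 : locring p) (@loc_scale A p M).
Proof.
elim/fracW=> m s; rewrite [1]/(rfrac 1 (denom1 p)) loc_scaleE.
apply/fracP; exists 1; first exact: spec1.
by rewrite /= ?(dvalM, dval1) !scale1r mul1r.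
Qed.

Lemma loc_scaleDr : right_distributive (@loc_scale A p M) +%R.
Proof.
elim/rfracW=> a s; elim/fracW=> m t; elim/fracW=> n w.
rewrite [_ + _]loc_addE !loc_scaleE [RHS]loc_addE.
apply/fracP; exists 1; first exact: spec1.
by rewrite /= ?(dvalM, dval1) !scalerDr !scalerA; congr (_ *: _ + _ *: _); ring.
Qed.

Lemma loc_scaleDl (v : locmod p M) :
  {morph (fun x : locring p => loc_scale x v) : x y / x + y}.
Proof.
move=> x y; move: x y v.
elim/rfracW=> a s; elim/rfracW=> b t; elim/fracW=> m w.
rewrite rfrac_add !loc_scaleE [RHS]loc_addE.
apply/fracP; exists 1; first exact: spec1.
by rewrite /= ?(dvalM, dval1) !scalerA -scalerDl !scalerA; congr (_ *: _); ring.
Qed.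

HB.instance Definition _ :=
  GRing.Zmodule_isLmodule.Build (locring p) (locmod p M)
    loc_scaleA loc_scale1 loc_scaleDr loc_scaleDl.

End LocalizationRingInstance.

Section LocalRing.
Variable R : comPzRingType.

(* The set of non-units, which is the maximal ideal when R is local; see
   [max_ideal_locring] below. *)
Definition max_ideal : set R := [set x | ~ exists y, y * x = 1].

Variable N : lmodType R.

Definition is_zero_mod : Prop := forall v : N, v = 0.

Definition smul (x : seq R) : set N :=
  [set v | exists c : 'I_(size x) -> N, v = \sum_(i < size x) x`_i *: c i].

Definition regular_seq (x : seq R) : Prop :=
  (forall i, (i < size x)%N ->
     forall v, smul (take i x) (x`_i *: v) -> smul (take i x) v)
  /\ smul x <> setT.

(* A nonempty set of naturals always has a supremum in [\bar int], so the
   default value -oo of [supremum] is only used for the empty set. *)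
Definition depth : \bar int :=
  if `[< is_zero_mod >] then +oo%E
  else supremum -oo%E
    [set (size x)%:Z%:E%E | x in [set x : seq R |
       (forall a, a \in x -> max_ideal a) /\ regular_seq x]].

Definition supp : set (spec R) :=
  [set q | ~ forall z : locmod q N, z = 0].

Definition supp_chain (k : nat) : Prop :=
  exists q : 'I_k.+1 -> spec R,
    (forall i, supp (q i)) /\
    (forall i j : 'I_k.+1, (i < j)%N -> spec_set (q i) `<` spec_set (q j)).

(* The dimension of the zero module is -oo. *)
Definition mdim : \bar int :=
  supremum -oo%E [set k%:Z%:E%E | k in [set k | supp_chain k]].

Definition cmd : \bar int :=
  if `[< is_zero_mod >] then 0%E else (mdim - depth)%E.

End LocalRing.

Lemma locring_nonzero (A : comPzRingType) (p : spec A) :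
  (1 : locring p) <> 0.
Proof.
move=> /(rfracP 1 0 (denom1 p) (denom1 p))[u pu].
rewrite mulr0 dval1 !mulr1 mulr0 => u0; apply: pu; rewrite u0.
by have [[]] := specP p.
Qed.

Lemma max_ideal_locring (A : comPzRingType) (p : spec A) (a : A) (s : denom p) :
  max_ideal (rfrac a s) <-> p a.
Proof.
have [[p0 pD pM] p1 pprime] := specP p; split=> [h|pa [y]].
  apply: contrapT => pa; apply: h; exists (rfrac (dval s) (mk_denom pa)).
  rewrite [LHS]loc_mulE; apply/(rfracP _ _ _ (denom1 p)); exists 1 => //.
  by rewrite !(dvalM, dval1) /=; ring.
elim/rfracW: y => b t; rewrite [X in X = _]loc_mulE.
case/rfracP => u pu; rewrite dvalM dval1 mul1r mulr1 => e.
apply: (specM pu (specM (@denomP _ _ t) (@denomP _ _ s))) => /=.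
rewrite -e; exact: (pM _ _ (pM _ _ pa)).
Qed.

Definition C_property (n l : nat) (A : comPzRingType) (M : lmodType A) : Prop :=
  forall p : spec A,
    (mine (mdim (locmod p M)) n%:Z%:E - l%:Z%:E <= depth (locmod p M))%E.

(* Main.v *)
(* For nonzero M_p, write d and h for the dimension and the depth of M_p.  As h
   is an integer or infinite, either h >= n - l, and the inequality of (C_n^l)
   holds, or h <= n - l - 1, and then min(d, n) - l <= h says d - h <= l. *)
Require Import Defs.
From mathcomp Require Import all_boot all_order all_algebra zify.
From mathcomp Require Import boolp classical_sets constructive_ereal.

Import Order.TTheory GRing.Theory Num.Theory.
Local Open Scope ring_scope.

(* At h = -oo both sides mean d = -oo, since -oo + +oo = -oo in [\bar int]. *)
Lemma mine_subr_le (d h : \bar int) (n l : int) :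
  (mine d n%:E - l%:E <= h)%E <-> ((h <= (n - l - 1)%:E)%E -> (d - h <= l%:E)%E).
Proof.
(* [leye_eq] and [leeNy_eq] turn bounds by an infinity into equalities, which fail for finite
   values. *)
have FE (x : int) :
  ((x%:E == +oo%E) = false) * ((x%:E == -oo%E) = false) by [].
case: d h => [d| |] [h| |] //=;
  rewrite ?miney ?minye ?mineNy ?minNye -?EFin_min -?EFinB ?addNye ?addeNy;
  rewrite ?addey ?addye // ?leey ?leNye ?leye_eq ?leeNy_eq ?lee_fin ?FE;
  (* At d = +oo with h finite, the minimum is n and d - h = +oo exceeds l, so both sides say n - l
     <= h. *)
  by split=> //; lia.
Qed.

Theorem proposition4p7 (A : comPzRingType) (hA : noetherian A)
    (M : lmodType A) (hM : fin_gen M) (n l : nat) :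
  C_property n l M <->
  (forall p : spec A,
     (depth (locmod p M) <= (n%:Z - l%:Z - 1)%:E)%E ->
     (cmd (locmod p M) <= l%:Z%:E)%E).
Proof.
(* The equivalence already holds at each prime separately. *)
suff H p : (mine (mdim (locmod p M)) n%:Z%:E - l%:Z%:E <= depth (locmod p M))%E
    <-> ((depth (locmod p M) <= (n%:Z - l%:Z - 1)%:E)%E ->
         (cmd (locmod p M) <= l%:Z%:E)%E).
  by split=> h p; apply/H; exact: h.
have [z|nz] := pselect (is_zero_mod (locmod p M)); last first.
  by rewrite /cmd (asboolF nz); exact: mine_subr_le.
(* Here [cmd] is 0 by convention, not [mdim - depth]; as the depth is +oo, both sides hold. *)
by rewrite /cmd /depth (asboolT z); split=> // _; exact: leey.
Qed.
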